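(* For each $i\in O$ and all real numbers $e_{jk}$ ($j\in D$, $k\in H$) and $f_{jm}$ ($j\in D$, $m\in H$) such that $$e_{jk}+f_{jm}\le C_{ijkm}\qquad \forall j\in D,\ k,m\in H,$$ the inequality $$\pi_i\ \ge\ \sum_{j\in D}\sum_{k\in H} e_{jk}\,x_{ik}+\sum_{j\in D}\sum_{m\in H} f_{jm}\,z_{ijm}$$ is valid for the formulation $((1,p)\text{-F})$.
   Context: An instance of the $(1,p)$-Allocation Hub Location Problem consists of nonempty finite sets $O$ (origins), $D$ (destinations), $H$ (potential hubs) of cardinalities $o,d,h$ respectively, an integer $p$ with $2\le p\le h-1$ (maximum number of hubs), and costs $C_{ijkm}\ge 0$ for all $(i,j,k,m)\in O\times D\times H\times H$. For fixed $i\in O$, $j\in D$, $k\in H$, sort the $h$ values $C_{ijkm}$, $m\in H$, in increasing order (with repetitions); $M_{ijk}$ denotes the $(h-p+1)$-th entry of this sorted vector. The formulation $((1,p)\text{-F})$ is the mixed-integer linear program in variables $y_k$ ($k\in H$), $x_{ik}$ ($i\in O,k\in H$), $z_{ijm}$ ($i\in O,j\in D,m\in H$), $\pi_i$ ($i\in O$): minimize $\sum_{i\in O}\pi_i$ subject to - $\sum_{k\in H} y_k\le p$; - $x_{ik}\le y_k$ for all $i\in O,k\in H$; - $\sum_{k\in H}x_{ik}=1$ for all $i\in O$; - $\sum_{i\in O}\sum_{j\in D} z_{ijm}\le o\cdot d\cdot y_m$ for all $m\in H$; - $\sum_{m\in H} z_{ijm}=1$ for all $i\in O,j\in D$; - $\pi_i\ge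 \sum_{j\in D}\Big(\sum_{m\in H} C_{ijkm}z_{ijm}+M_{ijk}(x_{ik}-1)\Big)$ for all $i\in O,k\in H$; - $\pi_i\ge 0$ for all $i\in O$; - $y_k\in\{0,1\}$, $x_{ik}\in\{0,1\}$, $z_{ijm}\in\{0,1\}$ for all $i\in O$, $j\in D$, $k,m\in H$. An inequality is valid for $((1,p)\text{-F})$ if it is satisfied by every feasible (mixed-integer) solution $(y,x,z,\pi)$ of $((1,p)\text{-F})$. *)

(* Defs.v *)
From mathcomp Require Import all_boot all_order all_algebra.

Set Implicit Arguments.
Unset Strict Implicit.
Unset Printing Implicit Defensive.

Import Order.TTheory GRing.Theory Num.Theory.
Local Open Scope ring_scope.

(* A point (y, x, z, pi) of the variable space; integrality is part of
   feasibility, as in a mixed-integer linear program. *)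
Record point (R : realFieldType) (O D H : finType) := Point {
  yv : H -> R;
  xv : O -> H -> R;
  zv : O -> D -> H -> R;
  piv : O -> R
}.

(* The (h - p + 1)-th entry, counted from 1, of the increasingly sorted
   vector (C i j k m)_m is the entry of 0-based index h - p. *)
Definition bigM (R : realFieldType) (O D H : finType) (p : nat)
    (C : O -> D -> H -> H -> R) (i : O) (j : D) (k : H) : R :=
  nth 0 (sort <=%R [seq C i j k m | m : H]) (#|H| - p)%N.

Definition binary (R : realFieldType) (a : R) : Prop := a = 0 \/ a = 1.

Record feasible (R : realFieldType) (O D H : finType) (p : nat)
    (C : O -> D -> H -> H -> R) (s : point R O D H) : Prop := Feasible {
  hub_count : \sum_k yv s k <= p%:R;
  origin_hub_open : forall i k, xv s i k <= yv s k;
  origin_hub_assigned : forall i, \sum_k xv s i k = 1;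
  dest_hub_open :
    forall m, \sum_i \sum_j zv s i j m <= #|O|%:R * #|D|%:R * yv s m;
  dest_hub_assigned : forall i j, \sum_m zv s i j m = 1;
  cost_bound : forall i k,
    piv s i >= \sum_j (\sum_m C i j k m * zv s i j m
                       + bigM p C i j k * (xv s i k - 1));
  cost_nonneg : forall i, piv s i >= 0;
  y_binary : forall k, binary (yv s k);
  x_binary : forall i k, binary (xv s i k);
  z_binary : forall i j m, binary (zv s i j m)
}.

Definition valid_inequality (R : realFieldType) (O D H : finType) (p : nat)
    (C : O -> D -> H -> H -> R) (lhs rhs : point R O D H -> R) : Prop :=
  forall s, feasible p C s -> lhs s >= rhs s.

(* Main.v *)
Require Import Defs.
From mathcomp Require Import all_boot all_order all_algebra.

Set Implicit Arguments.
Unset Strict Implicit.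
Unset Printing Implicit Defensive.

Import Order.TTheory GRing.Theory Num.Theory.
Local Open Scope ring_scope.

(** In a feasible point every origin [i] is assigned to exactly one hub [k0],
    because its [x]-values are binary and sum to one ([binary_sum1_delta]).  The
    cost constraint at [k0] loses its big-M term, so [piv s i] is at least the
    sum over [j] and [m] of [C i j k0 m * zv s i j m].  Since the [z]-values of
    each destination [j] are nonnegative and sum to one, they average the
    hypothesis [e j k0 + f j m <= C i j k0 m] into
    [e j k0 + \sum_m f j m * zv s i j m <= \sum_m C i j k0 m * zv s i j m];
    and [e j k0] is exactly [\sum_k e j k * xv s i k].  Summing over [j] gives
    the inequality. *)

Lemma binary_ge0 (R : realFieldType) (a : R) : binary a -> 0 <= a.
Proof. by case=> ->; rewrite ?ler01. Qed.

(** The sum is nonzero, so some value is one; the others are then nonnegative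
    with sum zero, hence all vanish. *)
Lemma binary_sum1_delta (R : realFieldType) (T : finType) (x : T -> R) :
    (forall t, binary (x t)) -> \sum_t x t = 1 ->
  exists t0, forall t, x t = (t == t0)%:R.
Proof.
move=> xb x1.
have [t0 /eqP xt0 | no1] := pickP (fun t => x t == 1); last first.
  move/eqP: x1; rewrite big1 ?(eq_sym 0) ?oner_eq0 // => t _.
  by case: (xb t) => // /eqP; rewrite no1.
exists t0 => t; have [-> // | tt0] := eqVneq t t0.
have rest0 : \sum_(u | u != t0) x u = 0.
  by move: x1; rewrite (bigD1 t0) //= xt0 -[RHS]addr0 => /addrI.
by apply: (psumr_eq0P _ rest0) => // u _; apply: binary_ge0.
Qed.

Lemma sum_mulr_delta (R : realFieldType) (T : finType) (c : T -> R) (t0 : T) :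
  \sum_t c t * (t == t0)%:R = c t0.
Proof.
rewrite (bigD1 t0) //= eqxx mulr1 big1 ?addr0 // => t /negPf ->.
by rewrite mulr0.
Qed.

(** Averaging a pointwise bound against the weights [w]; the constant [a] is
    its own average because the weights sum to one. *)
Lemma ler_weighted_sum (R : realFieldType) (T : finType) (w g c : T -> R)
    (a : R) :
    (forall t, 0 <= w t) -> \sum_t w t = 1 -> (forall t, a + g t <= c t) ->
  a + \sum_t g t * w t <= \sum_t c t * w t.
Proof.
move=> w0 w1 agc; rewrite -[a]mulr1 -w1 mulr_sumr -big_split /=.
by apply: ler_sum => t _; rewrite -mulrDl ler_wpM2r.
Qed.

Theorem proposition5p2 (R : realFieldType) (O D H : finType) (p : nat)
    (C : O -> D -> H -> H -> R)
    (O_nonempty : (0 < #|O|)%N) (D_nonempty : (0 < #|D|)%N)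
    (H_nonempty : (0 < #|H|)%N) (p_bounds : (2 <= p <= #|H| - 1)%N)
    (C_ge0 : forall i j k m, 0 <= C i j k m)
    (i : O) (e f : D -> H -> R)
    (ef_le_C : forall j k m, e j k + f j m <= C i j k m) :
  valid_inequality p C
    (fun s => piv s i)
    (fun s => \sum_j \sum_k e j k * xv s i k
              + \sum_j \sum_m f j m * zv s i j m).
Proof.
move=> s fs.
have [k0 xE] := binary_sum1_delta (x_binary fs i) (origin_hub_assigned fs i).
apply: le_trans (cost_bound fs i k0); rewrite -big_split /=.
apply: ler_sum => j _.
rewrite (eq_bigr (fun k => e j k * (k == k0)%:R)) => [|k _]; last by rewrite xE.
rewrite sum_mulr_delta xE eqxx subrr mulr0 addr0.
apply: ler_weighted_sum => [m||m] //; last exact: dest_hub_assigned fs i j.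
exact: binary_ge0 (z_binary fs i j m).
Qed.
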